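(* Let $\mu\in\mathbb{C}$ with $|\mu|\leq 1$ and let $\Phi(z)=\mu z$ for $z\in\mathbb{C}$. Then the composition operator $C_\Phi$ is unitary on $H_E(\xi)$ if and only if $|\mu|=1$.
   Context: Let $\xi=(\xi_n)_{n\ge 0}$ be a sequence of positive real numbers with $\lim_{n\to\infty}\xi_n^{1/n}=\infty$. $H_E(\xi)$ is the Hilbert space of entire functions $f(z)=\sum_{n=0}^\infty a_n z^n$ with $\|f\|^2=\sum_{n=0}^\infty |a_n|^2\xi_n^2<\infty$, with inner product $\langle f,g\rangle=\sum_{n=0}^\infty b_n\overline{c_n}\,\xi_n^2$ for $f=\sum b_nz^n$, $g=\sum c_nz^n$. For an entire function $\Phi$, the composition operator is $C_\Phi f=f\circ\Phi$; for $\Phi(z)=\mu z$ with $|\mu|\le 1$ it is bounded on $H_E(\xi)$. A bounded operator $S$ is unitary if $S^*S=SS^*=I$. *)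

(* Defs.v *)
From HB Require Import structures.
From mathcomp Require Export all_boot all_order all_algebra.
From mathcomp Require Export all_classical all_reals all_analysis.
From mathcomp Require Export complex.

Set Implicit Arguments.
Unset Strict Implicit.
Unset Printing Implicit Defensive.

Import Order.TTheory GRing.Theory Num.Theory.
Import numFieldNormedType.Exports.

Local Open Scope classical_set_scope.
Local Open Scope ring_scope.
Local Open Scope complex_scope.

(* [R[i]] on its own carries no topology; the regular module [R[i]^o] is the
   one-dimensional normed space over the field [R[i]], with norm [`|z|]. *)
Notation cplx R := ((R[i])^o) (only parsing).

Section HilbertSpaceOfEntireFunctions.
Variable R : realType.
Local Notation C := (cplx R).

(* The base field of [derivable] is [R[i]] here: this is complex
   differentiability at every point. *)
Definition entire (f : C -> C) : Prop := forall z : C, derivable f z 1.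

Definition has_power_series (f : C -> C) (a : nat -> C) : Prop :=
  forall z : C, series (fun n => a n * z ^+ n) @ \oo --> f z.

(* By the identity theorem at most one sequence represents [f]; the value is
   [0] when there is none, which never happens for [f] in [HE xi]. *)
Definition coefs (f : C -> C) : nat -> C :=
  xget (fun=> 0) [set a | has_power_series f a].

Variable xi : nat -> R.

(* [complex.Re] only retypes in [R] the modulus [`|a n| : R[i]], whose
   imaginary part is zero. *)
Definition sqnorm_term (a : nat -> C) (n : nat) : R :=
  complex.Re `|a n| ^+ 2 * xi n ^+ 2.

Definition HE : set (C -> C) :=
  [set f | entire f /\
     exists2 a : nat -> C, has_power_series f a
                         & cvgn (series (sqnorm_term a))].

Definition HE_inner (f g : C -> C) : C :=
  limn (series (fun n => coefs f n * conjc (coefs g n) * (xi n ^+ 2)%:C : C)).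

Definition HE_norm (f : C -> C) : R :=
  Num.sqrt (limn (series (sqnorm_term (coefs f)))).

(* An operator on [HE xi] is given by a map on all functions [C -> C], of which
   only the values on [HE xi] matter. *)
Definition bounded_operator (S : (C -> C) -> (C -> C)) : Prop :=
  [/\ forall f, HE f -> HE (S f),
      forall (c : C) f g, HE f -> HE g ->
        S (fun z => c * f z + g z) = (fun z => c * S f z + S g z)
    & exists M : R, forall f, HE f -> HE_norm (S f) <= M * HE_norm f].

Definition is_adjoint (S T : (C -> C) -> (C -> C)) : Prop :=
  bounded_operator T /\
  forall f g, HE f -> HE g -> HE_inner (S f) g = HE_inner f (T g).

Definition unitary (S : (C -> C) -> (C -> C)) : Prop :=
  bounded_operator S /\
  exists2 T, is_adjoint S T
           & forall f, HE f -> T (S f) = f /\ S (T f) = f.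

End HilbertSpaceOfEntireFunctions.

Definition composition_operator (R : realType) (Phi : cplx R -> cplx R)
  (f : cplx R -> cplx R) : cplx R -> cplx R := f \o Phi.

(* Main.v *)
(* Composition with z |-> mu z multiplies the n-th Taylor coefficient by mu^n.
   If |mu| = 1 this preserves all |a_n|, and composition with
   z |-> conj(mu) z is both the adjoint and the inverse.  Conversely,
   a unitary operator preserves the norm of the function z, which
   the composition multiplies by |mu|. *)
Require Import Defs.

Set Implicit Arguments.
Unset Strict Implicit.
Unset Printing Implicit Defensive.

Import Order.TTheory GRing.Theory Num.Theory.
Import numFieldNormedType.Exports.
Local Open Scope classical_set_scope.
Local Open Scope ring_scope.

Lemma sum_geometric_le2 (K : numFieldType) (r : K) (n : nat) :
  0 <= r -> r *+ 2 <= 1 -> \sum_(0 <= i < n) r ^+ i <= 2.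
Proof.
(* The sharper bound [2 - 2 r^n] survives induction: adding [r^n] needs only [2 r^(n+1) <= r^n]. *)
move=> r0 r2; apply: (@le_trans _ _ (2 - r ^+ n *+ 2)); last first.
  by rewrite gerBl mulrn_wge0 // exprn_ge0.
elim: n => [|n IHn]; first by rewrite big_geq // expr0 subrr.
rewrite big_nat_recr //=; apply: (le_trans (lerD IHn (lexx _))).
rewrite mulr2n opprD addrA subrK lerD2l lerN2 exprSr -mulrnAr.
by rewrite ler_piMr // exprn_ge0.
Qed.

(* If c_0, ..., c_(k-1) vanish and |c_n| <= M, then summing to 0 at z = r > 0
   forces |c_k| r^k <= (1 + 2M) r^(k+1), for r arbitrarily small. *)
Lemma power_series_eq0 (K : numFieldType) (c : nat -> K^o) :
  (forall z : K^o, series (fun n => c n * z ^+ n) @ \oo --> (0 : K^o)) ->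
  forall n, c n = 0.
Proof.
move=> c_sum.
(* Convergence at [z = 1] makes [c n] tend to 0, so it is bounded. *)
have [M M_gt0 cM] : exists2 M : K, 0 < M & forall n, `|c n| <= M.
  have /cvg_series_cvg_0 c_to0 : cvgn (series c).
    apply/cvg_ex; exists 0; have := c_sum 1.
    by under eq_fun do rewrite expr1n mulr1.
  have /cvg_seq_bounded /pinfty_ex_gt0[M M0 cM] : cvgn c.
    by apply/cvg_ex; exists 0.
  by exists M => // n; apply: cM.
elim/ltn_ind => k IHk.
have small r : 0 < r -> r *+ 2 <= 1 -> `|c k| <= (1 + M * 2) * r.
  move=> r0 r2.
  have rk0 : 0 < r ^+ k by rewrite exprn_gt0.
  have rk10 : 0 < r ^+ k.+1 by rewrite exprn_gt0.
  (* A partial sum of length [N + k.+1] is within [r^(k+1)] of 0; it splits into [k] vanishing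
     terms, the term of index [k] and [N] tail terms. *)
  have [N _ /(_ (N + k.+1)%N (leq_addr _ _))] :=
    cvgr0_norm_le _ (c_sum r) _ rk10.
  rewrite /series /= (big_cat_nat (n := k)) //=; last first.
    by rewrite addnS leqW // leq_addl.
  rewrite big_nat big1 ?add0r; last first.
    by move=> i /= ik; rewrite IHk ?mul0r.
  rewrite big_ltn; last by rewrite addnS ltnS leq_addl.
  rewrite -{1}[k.+1]add0n big_addn addnK => partial.
  have tail : `|\sum_(0 <= i < N) c (i + k.+1)%N * r ^+ (i + k.+1)|
      <= M * 2 * r ^+ k.+1.
    apply: (le_trans (ler_norm_sum _ _ _)).
    apply: (@le_trans _ _ (\sum_(0 <= i < N) M * r ^+ k.+1 * r ^+ i)).
      apply: ler_sum => i _; rewrite normrM exprD [r ^+ i * _]mulrC -mulrA.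
      have ri0 : 0 <= r ^+ k.+1 * r ^+ i by rewrite mulr_ge0 // exprn_ge0 // ltW.
      by rewrite [`|_ * _|]ger0_norm // ler_wpM2r.
    rewrite -mulr_sumr [leRHS]mulrAC ler_wpM2l ?sum_geometric_le2 ?(ltW r0) //.
    by rewrite mulr_ge0 // ltW.
  rewrite -(ler_pM2r rk0) -mulrA -exprS mulrDl mul1r.
  rewrite -{1}(ger0_norm (ltW rk0)) -normrM.
  (* The term of index [k] is the partial sum minus the tail, both already bounded. *)
  rewrite -[X in `|X|](addrK
    (\sum_(0 <= i < N) c (i + k.+1)%N * r ^+ (i + k.+1))).
  apply: (le_trans (ler_normB _ _)); exact: lerD.
have B_gt0 : 0 < 1 + M * 2 by rewrite addr_gt0 // mulr_gt0.
apply/eqP/negP => /negP; rewrite -normr_gt0 => ck_gt0.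
(* This [r] turns the bound into [|c k| <= |c k| / 2]; it is admissible since
   [|c k| <= M <= 1 + 2M]. *)
have : `|c k| <= (1 + M * 2) * (`|c k| / (1 + M * 2) / 2).
  apply: small; first by rewrite !divr_gt0.
  rewrite -[(_ / 2) *+ 2]mulr_natr divfK ?pnatr_eq0 // ler_pdivrMr // mul1r.
  apply: (le_trans (cM k)).
  by rewrite mulr_natr mulr2n addrA lerDr addr_ge0 // ltW.
rewrite mulrA [_ * (`|_| / _)]mulrC divfK ?gt_eqF //.
rewrite ler_pdivlMr // mulr_natr mulr2n.
by rewrite gerDl lt_geF.
Qed.

Lemma series_cvg_single (K : numFieldType) (V : normedModType K)
    (u : nat -> V) (k : nat) :
  (forall n, n != k -> u n = 0) -> series u @ \oo --> u k.
Proof.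
(* [series u n] sums over indices below [n], so it is constant from [k.+1] on. *)
move=> u0; apply: cvg_near_cst; exists k.+1 => // n /= kn.
rewrite /series /= (bigD1_seq k) ?iota_uniq ?mem_index_iota //=.
by rewrite big1 ?addr0.
Qed.

Section PowerSeriesCoefficients.
Variable R : realType.
Local Notation C := (cplx R).

(** Two expansions of [f] differ by a power series with sum 0, whose coefficients vanish. This makes
    the choice in [coefs] computable from any known expansion. *)
Lemma coefsE (f : C -> C) (a : nat -> C) :
  has_power_series f a -> coefs f = a.
Proof.
move=> fa; apply: xget_unique => // b fb; apply/funext => n; apply/eqP.
rewrite -subr_eq0; apply/eqP.
apply: (power_series_eq0 (c := fun n => b n - a n)) => z.
rewrite (_ : series _ = series (fun n => b n * z ^+ n)
                        - series (fun n => a n * z ^+ n)).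
  by rewrite -(subrr (f z)); apply: cvgB; [exact: fb|exact: fa].
apply/funext => k; rewrite fctE /series /= -sumrB.
by apply: eq_bigr => i _; rewrite mulrBl.
Qed.

Lemma has_power_series_dilation (m : C) (f : C -> C) (a : nat -> C) :
  has_power_series f a ->
  has_power_series (fun z => f (m * z)) (fun n => m ^+ n * a n).
Proof.
move=> fa z; have := fa (m * z).
by under eq_fun do rewrite exprMn mulrA [a _ * _]mulrC.
Qed.

Lemma entire_dilation (m : C) (f : C -> C) :
  entire f -> entire (fun z => f (m * z)).
Proof.
move=> fE z; apply/derivable1_diffP.
apply: (@differentiable_comp _ _ _ _ ( *%R m) f).
  by apply/derivable1_diffP; exact: (@derivableZ _ C C id m).
exact/derivable1_diffP/fE.
Qed.

Variable xi : nat -> R.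

Lemma HE_coefs (f : C -> C) : HE xi f ->
  has_power_series f (coefs f) /\ cvgn (series (sqnorm_term xi (coefs f))).
Proof. by case=> _ [a fa an]; rewrite (coefsE fa). Qed.

Lemma sqnorm_term_dilation (m : C) (a : nat -> C) : `|m| = 1 ->
  sqnorm_term xi (fun n => m ^+ n * a n) = sqnorm_term xi a.
Proof.
move=> m1; apply/funext => n.
by rewrite /sqnorm_term normrM normrX m1 expr1n mul1r.
Qed.

Lemma bounded_operator_rotation (m : C) : `|m| = 1 ->
  bounded_operator xi (composition_operator (fun z => m * z)).
Proof.
move=> m1; split=> [f HEf|c f g _ _|].
- split; first by apply: entire_dilation; case: HEf.
  have [fa an] := HE_coefs HEf.
  exists (fun n => m ^+ n * coefs f n); first exact: has_power_series_dilation.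
  by rewrite sqnorm_term_dilation.
- exact: erefl.
- exists 1 => f /HE_coefs[fa _].
  rewrite mul1r /HE_norm (coefsE (has_power_series_dilation (m := m) fa)).
  by rewrite sqnorm_term_dilation.
Qed.

Lemma HE_inner_dilation (m : C) (f g : C -> C) : HE xi f -> HE xi g ->
  HE_inner xi (fun z => f (m * z)) g = HE_inner xi f (fun z => g (conjc m * z)).
Proof.
move=> /HE_coefs[fa _] /HE_coefs[gb _]; rewrite /HE_inner.
rewrite (coefsE (has_power_series_dilation (m := m) fa)).
rewrite (coefsE (has_power_series_dilation (m := conjc m) gb)).
congr (limn (series _)); apply/funext => n.
rewrite (rmorphM (@conjc R)) (rmorphXn (@conjc R)) /= conjcK.
by rewrite [m ^+ n * _]mulrC !mulrA.
Qed.

Lemma has_power_series_linear (m : C) :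
  has_power_series ( *%R m) (fun n => if n == 1%N then m else 0).
Proof.
move=> z; have := @series_cvg_single _ C
  (fun n => (if n == 1%N then m else 0) * z ^+ n) 1%N.
by rewrite eqxx expr1; apply=> n /negPf ->; rewrite mul0r.
Qed.

Lemma HE_id : HE xi (fun z => z).
Proof.
split; first by move=> z; exact: derivable_id.
exists (fun n => if n == 1%N then 1 else 0).
  have -> : (fun z : C => z) = *%R 1 by apply/funext => z; rewrite mul1r.
  exact: has_power_series_linear.
apply/cvg_ex; eexists; apply: (@series_cvg_single _ R^o _ 1%N) => n /negPf n1.
by rewrite /sqnorm_term n1 normr0 expr0n mul0r.
Qed.

Lemma HE_inner_linear (m : C) :
  HE_inner xi ( *%R m) ( *%R m) = `|m| ^+ 2 * ((xi 1%N ^+ 2)%:C)%C.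
Proof.
rewrite /HE_inner (coefsE (@has_power_series_linear m)) sqr_normc.
apply: cvg_lim; first exact: norm_hausdorff.
by apply: (@series_cvg_single _ C _ 1%N) => n /negPf ->; rewrite !mul0r.
Qed.

End PowerSeriesCoefficients.

Theorem theorem2p3 (R : realType) (xi : nat -> R)
    (xi_gt0 : forall n : nat, 0 < xi n)
    (xi_lim : (xi n `^ (n%:R^-1)) @[n --> \oo] --> +oo)
    (mu : cplx R) (mu_le1 : `|mu| <= 1)
    (Phi : cplx R -> cplx R) (PhiE : forall z : cplx R, Phi z = mu * z) :
  unitary xi (composition_operator Phi) <-> `|mu| = 1.
Proof.
have -> : Phi = *%R mu by apply/funext.
split=> [[[CHE _ _] [T [_ adj] TK]]|mu1].
  have idE : (fun z : cplx R => z) = *%R 1.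
    by apply/funext => z; rewrite mul1r.
  have HEid := @HE_id R xi.
  have := adj _ _ HEid (CHE _ HEid); rewrite (TK _ HEid).1 /=.
  rewrite /composition_operator /comp HE_inner_linear idE HE_inner_linear.
  rewrite normr1 expr1n => /mulIf mu2.
  apply/eqP; rewrite -(@pexpr_eq1 _ _ 2) // mu2 //.
  by rewrite fmorph_eq0 expf_neq0 // gt_eqF.
split; first exact: bounded_operator_rotation.
have muJ : mu * conjc mu = 1 by rewrite -sqr_normc mu1 expr1n.
exists (composition_operator ( *%R (conjc mu))).
  split; first by apply: bounded_operator_rotation; rewrite normcJ.
  exact: HE_inner_dilation.
move=> f _; rewrite /composition_operator.
split; apply/funext => z /=; congr (f _); rewrite mulrA.
  by rewrite muJ mul1r.
by rewrite [_ * mu]mulrC muJ mul1r.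
Qed.
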